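(* Let $T$ be a tournament with $n$ vertices, let $\delta_T$ denote the number of diamonds in $T$, and let $S$ be the Seidel adjacency matrix of $T$. Then: (1) If $n$ is even, then $\delta_T\leq \frac{1}{96}n^2(n-1)(n-2)$, and equality holds if and only if $n\equiv 0\pmod 4$ and $S$ is a skew-conference matrix. (2) If $n$ is odd, then $\delta_T\leq \frac{1}{96}n(n-1)(n-3)(n+1)$, and equality holds if and only if $n\equiv 3\pmod 4$ and $S$ is obtained by deleting a row and the corresponding column from a skew-conference matrix (of order $n+1$).
   Context: A tournament on vertices $v_1,\dots,v_n$ has adjacency matrix $A=(a_{ij})$ with $a_{ij}=1$ if $v_i$ dominates $v_j$ and $0$ otherwise; its Seidel adjacency matrix is $S=A-A^T$. A diamond is a 4-vertex tournament containing exactly one directed 3-cycle (equivalently, a vertex dominating, or dominated by, a 3-cycle); $\delta_T$ is the number of 4-element vertex subsets of $T$ inducing a diamond. A skew-conference matrix of order $m$ is an $m\times m$ matrix $C$ with zero diagonal, off-diagonal entries in $\{-1,1\}$, $C^T=-C$, and $CC^T=(m-1)I_m$.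
   Formalization: The equality characterizations are stated for n ≠ 2 in (1) and n ≠ 1 in (2), since for n = 2 and n = 1 both the bound and the number of diamonds are 0 although the congruence on n fails; the bounds are stated for every n. *)

(* Defs.v *)
From mathcomp Require Export all_boot all_order all_algebra.

Set Implicit Arguments.
Unset Strict Implicit.
Unset Printing Implicit Defensive.

Import GRing.Theory.
Local Open Scope ring_scope.

(* dom x y means that x dominates y. *)
Definition tournament (V : finType) (dom : rel V) : Prop :=
  irreflexive dom /\ forall x y : V, x != y -> dom x y (+) dom y x.

(* In a tournament, three vertices carry at most one directed 3-cycle, so
   directed 3-cycles are identified with their vertex sets. *)
Definition is_3cycle (V : finType) (dom : rel V) (B : {set V}) : bool :=
  [exists x, exists y, exists z,
    [&& B == [set x; y; z], dom x y, dom y z & dom z x]].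

Definition is_diamond (V : finType) (dom : rel V) (X : {set V}) : bool :=
  (#|X| == 4%N) &&
  (#|[set B : {set V} | (B \subset X) && is_3cycle dom B]| == 1%N).

Definition diamonds (V : finType) (dom : rel V) : nat :=
  #|[set X : {set V} | is_diamond dom X]|.

Definition adjacency (n : nat) (dom : rel 'I_n) : 'M[int]_n :=
  \matrix_(i, j) (dom i j)%:R.

Definition seidel (n : nat) (dom : rel 'I_n) : 'M[int]_n :=
  adjacency dom - (adjacency dom)^T.

Definition skew_conference (m : nat) (C : 'M[int]_m) : Prop :=
  [/\ forall i, C i i = 0,
      forall i j, i != j -> C i j = -1 \/ C i j = 1,
      C^T = - C &
      C *m C^T = (m%:R - 1)%:M].

(* Main.v *)
(** Let [S] be the Seidel matrix. The sum of [S_ij S_jk S_kl S_li] over all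
    quadruples is the squared Frobenius norm of [S S^T]; a 4-set of vertices
    contributes [-24] to it if it is a diamond and [8] otherwise, so counting
    diamonds amounts to evaluating the sum [G] of the squared off-diagonal
    entries of [S S^T], with [96 delta = n^2 (n - 1) (n - 2) - 3 G].
    For [n] even, [G >= 0], with equality iff [S S^T = (n - 1) I]. For [n] odd
    these entries are odd, so [G >= n (n - 1)], with equality iff they are all
    [1] or [-1]. A congruence modulo 4 for triples of rows then shows that they
    have the form [e v_i v_j] with [e] and [v_i] signs; commutation of [S] with
    [S S^T] gives [S v = 0] and [e = -1], and bordering [S] by [v] yields the
    skew-conference matrix. *)

Require Import Defs.
From mathcomp Require Import all_boot all_order all_algebra.
From mathcomp Require Import ring lra zify.

Set Implicit Arguments.
Unset Strict Implicit.
Unset Printing Implicit Defensive.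

Import Order.TTheory GRing.Theory Num.Theory.
Local Open Scope ring_scope.

(** * Sums over tuples and indicator sums *)

Section FiniteSums.

Variable V : finType.

Lemma sum_tuple_cons (m : nat) (F : m.+1.-tuple V -> int) :
  \sum_t F t = \sum_x \sum_(t : m.-tuple V) F [tuple of x :: t].
Proof.
rewrite pair_bigA /=.
rewrite (reindex (fun p : V * m.-tuple V => [tuple of p.1 :: p.2])) //=.
exists (fun t : m.+1.-tuple V => (thead t, [tuple of behead t])).
  by case=> x t _ /=; congr pair; apply: val_inj.
by move=> t _ /=; rewrite -tuple_eta.
Qed.

Lemma sum_tuple0 (F : 0.-tuple V -> int) : \sum_t F t = F [tuple].
Proof.
by rewrite (big_pred1 [tuple]) // => t; rewrite [t]tuple0 /= eq_refl.
Qed.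

Lemma card_tuples_of_set (m : nat) (X : {set V}) : #|X| = m ->
  #|[set t : m.-tuple V | uniq t && ([set x in t] == X)]| = (m ^_ m)%N.
Proof.
move=> Xm; rewrite -[X in (X ^_ _)%N]Xm -card_uniq_tuples; apply: eq_card => t.
rewrite !inE andbC; apply/andP/andP => -[].
  move=> /eqP <- U; split=> //; apply/allP => x xt.
  by change (x \in [set y in t]); rewrite inE.
move=> /allP tX U; split=> //.
rewrite eqEcard; apply/andP; split.
  by apply/subsetP => x; rewrite inE => /tX.
by rewrite cardsE (card_uniqP U) size_tuple Xm.
Qed.

(** Each 4-set has 4! = 24 orderings; nested sums become sums over 4-tuples, which are then grouped
    by underlying set. *)
Lemma sum_quadruples (g : {set V} -> int) :
  \sum_i \sum_j \sum_k \sum_l (uniq [:: i; j; k; l])%:R * g [set i; j; k; l]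
    = 24 * \sum_(X : {set V} | #|X| == 4%N) g X.
Proof.
transitivity (\sum_(t : 4.-tuple V) (uniq t)%:R * g [set x in t]).
  rewrite sum_tuple_cons; apply: eq_bigr => i _.
  rewrite sum_tuple_cons; apply: eq_bigr => j _.
  rewrite sum_tuple_cons; apply: eq_bigr => k _.
  rewrite sum_tuple_cons; apply: eq_bigr => l _.
  rewrite sum_tuple0; congr (_ * g _); apply/setP => x.
  by rewrite !inE -!orbA.
transitivity (\sum_(t : 4.-tuple V | uniq t) g [set x in t]).
  rewrite [RHS]big_mkcond; apply: eq_bigr => t _.
  by case: (uniq t); rewrite ?mul1r ?mul0r.
rewrite (partition_big (fun t : 4.-tuple V => [set x in t])
  (fun X : {set V} => #|X| == 4%N)) /=; last first.
  by move=> t U; rewrite cardsE (card_uniqP U) size_tuple.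
rewrite mulr_sumr; apply: eq_bigr => X /eqP X4.
rewrite (eq_bigr (fun=> g X)); last by move=> t /andP [_ /eqP ->].
by rewrite sumr_const -cardsE card_tuples_of_set // mulr_natl.
Qed.

Lemma sum_neq (x : V) : \sum_y (x != y)%:R = #|V|%:R - 1 :> int.
Proof.
have -> : #|V|%:R = \sum_(y : V) 1 :> int by rewrite sumr_const.
rewrite (bigD1 x) //= eqxx add0r [in RHS](bigD1 x) //= [X in X - _]addrC addrK.
by apply: eq_bigr => y; rewrite eq_sym => ->.
Qed.

Lemma sum_pick (F : V -> int) x : \sum_y (x == y)%:R * F y = F x.
Proof.
rewrite (bigD1 x) //= eqxx mul1r big1 ?addr0 // => y.
by rewrite eq_sym => /negPf ->; rewrite mul0r.
Qed.

Lemma sum_card_const (c : int) : \sum_(x : V) c = #|V|%:R * c.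
Proof. by rewrite sumr_const mulr_natl. Qed.

End FiniteSums.

(** * Signs of a tournament and their Gram entries *)

Section Tournament.

Variables (V : finType) (dom : rel V).
Hypothesis dom_tournament : tournament dom.

(** The entry of the Seidel matrix [S], over an arbitrary finite vertex type. *)
Definition sgn_dom (x y : V) : int := (dom x y)%:R - (dom y x)%:R.

(** The entry of [S S^T]. *)
Definition sgn_gram (x y : V) : int := \sum_z sgn_dom x z * sgn_dom y z.

Lemma dom_irr x : dom x x = false.
Proof. by case: dom_tournament => irr _; apply: irr. Qed.

Lemma dom_antisym x y : x != y -> dom y x = ~~ dom x y.
Proof.
by case: dom_tournament => _ tot /tot; case: (dom x y); case: (dom y x).
Qed.

Lemma sgn_domxx x : sgn_dom x x = 0. Proof. exact: subrr. Qed.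

Lemma sgn_domC x y : sgn_dom y x = - sgn_dom x y.
Proof. by rewrite /sgn_dom opprB. Qed.

Lemma sgn_domE x y : x != y -> sgn_dom x y = if dom x y then 1 else -1.
Proof. by move=> xy; rewrite /sgn_dom (dom_antisym xy); case: (dom x y). Qed.

Lemma sgn_dom_sqr x y : sgn_dom x y ^+ 2 = (x != y)%:R.
Proof.
have [->|xy] := eqVneq x y; first by rewrite sgn_domxx.
by rewrite sgn_domE //; case: (dom x y).
Qed.

(** * Directed 3-cycles and diamonds *)

Definition cyc3 x y z :=
  [&& dom x y, dom y z & dom z x] || [&& dom x z, dom z y & dom y x].

Lemma is_3cycleE x y z :
  is_3cycle dom [set x; y; z] = cyc3 x y z.
Proof.
apply/idP/idP; last first.
  case/orP => H; apply/existsP; exists x; apply/existsP.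
    exists y; apply/existsP; exists z; by rewrite eqxx H.
  exists z; apply/existsP; exists y; rewrite H andbT.
  by apply/eqP/setP=> t; rewrite !inE -!orbA [(t == y) || _]orbC.
case/existsP=> a /existsP [b /existsP [c /and4P [/eqP E ab bc ca]]].
have mem t : t \in [set a; b; c] -> [|| t == x, t == y | t == z].
  by rewrite -E !inE orbA.
have := mem a; have := mem b; have := mem c.
rewrite !inE !eqxx !orbT => /(_ isT) Hc /(_ isT) Hb /(_ isT) Ha; rewrite /cyc3.
case/or3P: Ha ab ca => /eqP->; case/or3P: Hb bc => /eqP->;
  case/or3P: Hc => /eqP->; rewrite ?dom_irr // => -> -> ->; rewrite ?orbT //.
Qed.

Lemma is_3cycle_card B : is_3cycle dom B -> #|B| = 3.
Proof.
case/existsP=> a /existsP [b /existsP [c /and4P [/eqP -> ab bc ca]]].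
have neq u v : dom u v -> u != v.
  by apply: contraL => /eqP->; rewrite dom_irr.
have <- : #|[:: a; b; c]| = 3.
  apply/card_uniqP; rewrite /= !inE negb_or [a == c]eq_sym.
  by rewrite (neq _ _ ca) (neq _ _ ab) (neq _ _ bc).
by apply: eq_card => t; rewrite !inE -!orbA.
Qed.

(** A 3-cycle has three vertices, so inside a 4-set it omits exactly one; [v] ranges over the
    omitted vertex. *)
Lemma card_3cycles_in (X : {set V}) : #|X| = 4 ->
  #|[set B : {set V} | (B \subset X) && is_3cycle dom B]|
    = (\sum_(v in X) is_3cycle dom (X :\ v))%N.
Proof.
move=> X4.
rewrite -sum1dep_card.
have -> : (\sum_(v in X) is_3cycle dom (X :\ v) =
  \sum_(v in [set v in X | is_3cycle dom (X :\ v)]) 1)%N.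
  rewrite [RHS](eq_bigl (fun v => (v \in X) && is_3cycle dom (X :\ v))).
    by rewrite big_mkcondr; apply: eq_bigr => v _; case: is_3cycle.
  by move=> v; rewrite inE.
rewrite !sum1dep_card; rewrite [RHS]cardsE.
rewrite -(card_in_imset (f := fun v => X :\ v)); last first.
  move=> u v; rewrite !inE => /andP [uX _] /andP [vX _] /setP /(_ u).
  by rewrite !inE eqxx uX /= andbT => /esym/negbFE/eqP.
apply: eq_card => B; rewrite !inE; apply/idP/imsetP.
  case/andP=> BX B3; have B3c := is_3cycle_card B3.
  have : #|X :\: B| == 1%N by rewrite cardsD (setIidPr BX) X4 B3c.
  case/cards1P=> v Ev; have EB : B = X :\ v.
    by rewrite -Ev setDDr setDv set0U (setIidPr BX).
  exists v => //; have : v \in X :\: B by rewrite Ev set11.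
  by rewrite !inE -EB B3 => /andP [_ ->].
case=> v; rewrite !inE => /andP [vX H] ->.
by rewrite H subD1set.
Qed.

(** Reduces being a diamond to a boolean expression in the arcs, ready for case analysis. *)
Lemma is_diamondE i j k l : uniq [:: i; j; k; l] ->
  is_diamond dom [set i; j; k; l] =
    (cyc3 j k l + cyc3 i k l + cyc3 i j l + cyc3 i j k == 1)%N.
Proof.
move=> U; rewrite /is_diamond.
have X4 : #|[set i; j; k; l]| = 4.
  have <- : #|[:: i; j; k; l]| = 4 by apply/card_uniqP.
  by apply: eq_card => t; rewrite !inE -!orbA.
rewrite X4 eqxx /= card_3cycles_in //.
rewrite (eq_bigl (fun v => v \in [:: i; j; k; l])); last first.
  by move=> v; rewrite !inE -!orbA.
rewrite -big_uniq //= !big_cons big_nil addn0 !addnA.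
move: (U); rewrite /= !inE !negb_or andbT.
case/and3P=> /and3P [ij ik il] /andP [jk jl] kl.
have D (a b c d : V) : [&& a != b, a != c & a != d] ->
    [set a; b; c; d] :\ a = [set b; c; d].
  case/and3P => ab ac ad; apply/setP => t; rewrite !inE -!orbA.
  by have [->|] := eqVneq t a; rewrite ?(negPf ab) ?(negPf ac) ?(negPf ad).
have P2 : [set i; j; k; l] = [set j; i; k; l].
  by rewrite -!setUA [RHS]setUCA.
have P3 : [set i; j; k; l] = [set k; i; j; l].
  by apply/setP => t; rewrite !inE -!orbA; case: (t == i); case: (t == j);
    case: (t == k); case: (t == l).
have P4 : [set i; j; k; l] = [set l; i; j; k].
  by apply/setP => t; rewrite !inE -!orbA; case: (t == i); case: (t == j);
    case: (t == k); case: (t == l).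
rewrite D ?ij ?ik // {1}P2 D ?(eq_sym j i) ?ij ?jk // {1}P3.
rewrite D ?(eq_sym k i) ?(eq_sym k j) ?ik ?jk // P4.
rewrite D ?(eq_sym l i) ?(eq_sym l j) ?(eq_sym l k) ?il ?jl //.
by rewrite !is_3cycleE.
Qed.

(** * Signed closed walks of length 4 *)

Definition walk4 i j k l : int :=
  sgn_dom i j * sgn_dom j k * sgn_dom k l * sgn_dom l i.

(** The three walks are the three cyclic orders of a 4-set; reversing one flips four signs and keeps
    the product. All three products are -1 on a diamond, and exactly one is otherwise, by checking
    the 64 orientations. *)
Lemma walk4_diamond i j k l : uniq [:: i; j; k; l] ->
  walk4 i j k l + walk4 i j l k + walk4 i k j l =
    1 - 4 * (is_diamond dom [set i; j; k; l])%:R.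
Proof.
move=> U; rewrite is_diamondE //; move: U; rewrite /= !inE !negb_or andbT.
case/and3P=> /and3P [ij ik il] /andP [jk jl] kl.
rewrite /walk4 /cyc3 (sgn_domC i l) (sgn_domC k l)
  (sgn_domC i k) (sgn_domC j k).
rewrite !sgn_domE //.
rewrite (dom_antisym ij) (dom_antisym ik) (dom_antisym il) (dom_antisym jk)
  (dom_antisym jl) (dom_antisym kl).
by case: (dom i j); case: (dom i k); case: (dom i l); case: (dom j k);
  case: (dom j l); case: (dom k l).
Qed.

(** A walk with two equal consecutive vertices contributes 0. The other degenerate walks have
    [i = k] or [j = l] and are products of squared signs, hence 1; the last term corrects for both
    equalities holding at once. *)
Lemma walk4_split i j k l :
  walk4 i j k l =
    (uniq [:: i; j; k; l])%:R * walk4 i j k l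
    + (i == k)%:R * ((i != j)%:R * (i != l)%:R)
    + (j == l)%:R * ((i != j)%:R * (k != j)%:R)
    - (i == k)%:R * ((j == l)%:R * (i != j)%:R).
Proof.
rewrite /= !inE !negb_or /walk4.
have [->|ij] := eqVneq i j; first by rewrite sgn_domxx /=; ring.
have [il|il] := eqVneq i l.
  by subst; rewrite sgn_domxx andbF [j == l]eq_sym (negPf ij);
    case: (l == k); rewrite /=; ring.
have [jk|jk] := eqVneq j k.
  by subst; rewrite sgn_domxx andbF (negPf ij) /=; ring.
have [kl|kl] := eqVneq k l.
  by subst; rewrite sgn_domxx !andbF (negPf il) (negPf jk) /=; ring.
have [ik|ik] := eqVneq i k; have [jl|jl] := eqVneq j l; subst; rewrite /=;
  rewrite ?(eq_sym k) ?jk ?ij ?jl //=.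
- rewrite (sgn_domC k l); have := sgn_dom_sqr k l; rewrite kl => E.
  by transitivity ((sgn_dom k l ^+ 2) ^+ 2); [ring | rewrite E /=; ring].
- rewrite (sgn_domC k j) (sgn_domC k l).
  have := sgn_dom_sqr k l; have := sgn_dom_sqr k j; rewrite kl (eq_sym k j) jk => E F.
  by transitivity ((sgn_dom k j ^+ 2) * (sgn_dom k l ^+ 2));
    [ring | rewrite E F /=; ring].
- rewrite (sgn_domC k l) (sgn_domC i l).
  have := sgn_dom_sqr i l; have := sgn_dom_sqr k l; rewrite kl il => E F.
  by transitivity ((sgn_dom k l ^+ 2) * (sgn_dom i l ^+ 2));
    [ring | rewrite E F /=; ring].
- ring.
Qed.


Lemma sgn_gram_sqr_walk4 x y :
  sgn_gram x y ^+ 2 = \sum_z \sum_t walk4 x z y t.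
Proof.
rewrite expr2 /sgn_gram big_distrlr /=; apply: eq_bigr => z _.
apply: eq_bigr => t _; rewrite /walk4 (sgn_domC y z) (sgn_domC x t); ring.
Qed.

Lemma sum_walk4_uniq :
  3 * (\sum_i \sum_j \sum_k \sum_l (uniq [:: i; j; k; l])%:R * walk4 i j k l)
    = #|V|%:R * (#|V|%:R - 1) * (#|V|%:R - 2) * (#|V|%:R - 3)
      - 96 * (diamonds dom)%:R.
Proof.
pose f i j k l := (uniq [:: i; j; k; l])%:R * walk4 i j k l.
(* Swapping [k] with [l], or [j] with [k], only renames summation variables, so three copies of the
   sum can carry the three cyclic orders. *)
transitivity (\sum_i \sum_j \sum_k \sum_l (f i j k l + f i j l k + f i k j l)).
  have -> (a : int) : 3 * a = a + a + a by ring.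
  rewrite -!big_split /=.
  apply: eq_bigr => i _.
  under [RHS]eq_bigr => j _ do
    (under eq_bigr => k _ do rewrite !big_split /=; rewrite !big_split /=).
  rewrite !big_split /=; congr (_ + _ + _).
    by apply: eq_bigr => j _; rewrite exchange_big.
  by rewrite exchange_big.
transitivity (\sum_i \sum_j \sum_k \sum_l (uniq [:: i; j; k; l])%:R *
    (1 - 4 * (is_diamond dom [set i; j; k; l])%:R) : int).
  apply: eq_bigr => i _; apply: eq_bigr => j _; apply: eq_bigr => k _.
  apply: eq_bigr => l _; rewrite /f.
  have -> : uniq [:: i; j; l; k] = uniq [:: i; j; k; l].
    by apply: perm_uniq; apply/permP => a /=; lia.
  have -> : uniq [:: i; k; j; l] = uniq [:: i; j; k; l].
    by apply: perm_uniq; apply/permP => a /=; lia.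
  case U : (uniq _); last by rewrite !mul0r !addr0.
  by rewrite !mul1r walk4_diamond.
rewrite (sum_quadruples (fun X => 1 - 4 * (is_diamond dom X)%:R)) big_split /=.
rewrite sumrN -mulr_sumr sumr_const.
have -> : \sum_(X : {set V} | #|X| == 4%N) (is_diamond dom X)%:R =
    (diamonds dom)%:R :> int.
  rewrite /diamonds -sum1dep_card natr_sum big_mkcond [RHS]big_mkcond /=.
  apply: eq_bigr => X _; rewrite /is_diamond; case: (_ == _) => //=.
  by case: (_ == _).
have -> : #|[pred X : {set V} | #|X| == 4%N]| = 'C(#|V|, 4).
  by rewrite -cardsE card_draws.
have := bin_ffact #|V| 4; move: 'C(_, _) => b.
move/(congr1 (fun m => m%:R : int)); rewrite natrM.
(* For [n] below 4 both sides vanish, so truncated subtraction does no harm. *)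
set n := #|V|; have -> : (n ^_ 4)%:R = 
  n%:R * (n%:R - 1) * (n%:R - 2) * (n%:R - 3) :> int.
  case: n => [|[|[|[|n]]]] //; rewrite /falling_factorial /ffact_rec /=.
  rewrite !natrM -![n.+4]addn1 -[n.+3]addn1 ; ring.
by move=> <-; rewrite -[4`!]/24%N; ring.
Qed.

(** * The sum [G] of squared off-diagonal Gram entries, and its link with diamonds *)

Definition gram_offdiag : int :=
  \sum_x \sum_y (x != y)%:R * sgn_gram x y ^+ 2.

Lemma sgn_gramC x y : sgn_gram y x = sgn_gram x y.
Proof. by apply: eq_bigr => z _; rewrite mulrC. Qed.

Lemma sgn_gramxx x : sgn_gram x x = #|V|%:R - 1.
Proof.
by rewrite -(sum_neq x); apply: eq_bigr => z _; rewrite -expr2 sgn_dom_sqr.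
Qed.

Lemma sum_sgn_gram_sqr :
  \sum_x \sum_y sgn_gram x y ^+ 2 =
    #|V|%:R * (#|V|%:R - 1) ^+ 2 + gram_offdiag.
Proof.
rewrite -sum_card_const -big_split /=; apply: eq_bigr => x _.
rewrite -(sgn_gramxx x) -(sum_pick (fun y => sgn_gram x y ^+ 2) x) -big_split /=.
by apply: eq_bigr => y _; case: (x == y); rewrite /= ?mul1r ?mul0r ?addr0 ?add0r.
Qed.

(** Sums the splitting of [walk4]: each of the shapes [i = k] and [j = l] accounts for [n (n - 1)^2]
    walks, and [n (n - 1)] walks have both shapes. *)
Lemma sum_walk4 :
  \sum_i \sum_j \sum_k \sum_l walk4 i j k l =
    \sum_i \sum_j \sum_k \sum_l (uniq [:: i; j; k; l])%:R * walk4 i j k l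
    + #|V|%:R * (#|V|%:R - 1) ^+ 2
    + #|V|%:R * (#|V|%:R - 1) ^+ 2
    - #|V|%:R * (#|V|%:R - 1).
Proof.
rewrite -!sum_card_const -sumrN -!big_split /=; apply: eq_bigr => i _.
have -> : (#|V|%:R - 1) ^+ 2 = \sum_j (i != j)%:R * (#|V|%:R - 1) :> int.
  by rewrite -mulr_suml sum_neq expr2.
rewrite -{3}(sum_neq i) -sumrN -!big_split /=; apply: eq_bigr => j _.
(* [E], [F] and [G] spread the closed forms over [k], so that the two sides can be compared term by
   term. *)
have E : (i != j)%:R * (#|V|%:R - 1) =
    \sum_k (i == k)%:R * ((i != j)%:R * (#|V|%:R - 1)) :> int.
  by rewrite (sum_pick (fun=> _)).
have F : (i != j)%:R * (#|V|%:R - 1) = \sum_k (i != j)%:R * (k != j)%:R :> int.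
  rewrite -mulr_sumr; congr (_ * _); rewrite -(sum_neq j).
  by apply: eq_bigr => k _; rewrite eq_sym.
have G : (i != j)%:R = \sum_k (i == k)%:R * (i != j)%:R :> int.
  by rewrite (sum_pick (fun=> _)).
rewrite [X in _ + X - _]F [X in _ + X + _ - _]E [X in _ - X]G.
rewrite -sumrN -!big_split /=; apply: eq_bigr => k _.
rewrite -(sum_neq i) mulr_sumr mulr_sumr.
rewrite -[X in _ + X - _](sum_pick (fun=> (i != j)%:R * (k != j)%:R) j).
rewrite -[X in _ - _ * X](sum_pick (fun=> (i != j)%:R) j) mulr_sumr.
rewrite -sumrN -!big_split /=.
by apply: eq_bigr => l _; rewrite [LHS]walk4_split.
Qed.

Theorem diamonds_gram_offdiag :
  96 * (diamonds dom)%:R =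
    #|V|%:R ^+ 2 * (#|V|%:R - 1) * (#|V|%:R - 2) - 3 * gram_offdiag.
Proof.
have := sum_sgn_gram_sqr; have := sum_walk4_uniq; have := sum_walk4.
(* The opposite vertices [i] and [k] index the Gram entry; [j] and [l] come from expanding its
   square. *)
have -> : \sum_i \sum_j \sum_k \sum_l walk4 i j k l =
    \sum_x \sum_y sgn_gram x y ^+ 2.
  apply: eq_bigr => i _; rewrite exchange_big; apply: eq_bigr => k _ /=.
  by rewrite sgn_gram_sqr_walk4.
set U := \sum_i \sum_j \sum_k \sum_l (uniq [:: i; j; k; l])%:R * walk4 i j k l.
move: U (gram_offdiag) (#|V|%:R) ((diamonds dom)%:R) => U G n d -> E F.
have -> : 3 * G = 3 * (U + n * (n - 1) ^+ 2 + n * (n - 1) ^+ 2 - n * (n - 1))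
  - 3 * n * (n - 1) ^+ 2 by rewrite F; ring.
have -> : 96 * d = n * (n - 1) * (n - 2) * (n - 3) - 3 * U by rewrite E; ring.
ring.
Qed.

(* Each term [(s_xt + s_yt) (s_xt + s_zt)] with [t] outside [{x, y, z}] is a
   product of two even numbers. *)
Lemma sgn_gram_mod4 x y z : uniq [:: x; y; z] ->
  (4 %| #|V|%:R + sgn_gram x y + sgn_gram x z + sgn_gram y z)%Z.
Proof.
rewrite /= !inE negb_or andbT => /andP [/andP [xy xz] yz].
pose h t := (sgn_dom x t + sgn_dom y t) * (sgn_dom x t + sgn_dom z t).
(* [a], [b], [c] are the values of [h] at [x], [y], [z], to be removed from the sum. *)
pose a := sgn_dom y x * sgn_dom z x.
pose b := 1 + sgn_dom x y * sgn_dom z y.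
pose c := 1 + sgn_dom x z * sgn_dom y z.
have H : (4 %|
    \sum_t (h t - (x == t)%:R * a - (y == t)%:R * b - (z == t)%:R * c))%Z.
  apply: rpred_sum => t _; rewrite /h /a /b /c.
  have [xt|xt] := eqVneq x t.
    subst t; rewrite sgn_domxx (eq_sym y) (negPf xy) (eq_sym z) (negPf xz).
    by rewrite !mul0r mul1r !add0r !subr0 subrr.
  have [yt|yt] := eqVneq y t.
    subst t; rewrite sgn_domxx (eq_sym z) (negPf yz) !mul0r mul1r addr0 !subr0.
    by rewrite (sgn_domE xy) (sgn_domC y z) (sgn_domE yz); case: dom; case: dom.
  have [zt|zt] := eqVneq z t.
    subst t; rewrite sgn_domxx !mul0r mul1r addr0 !subr0.
    by rewrite (sgn_domE xz) (sgn_domE yz); case: dom; case: dom.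
  rewrite !mul0r !subr0 !sgn_domE //.
  by case: (dom x t); case: (dom y t); case: (dom z t).
move: H; rewrite !big_split /= !sumrN !(sum_pick (fun=> _)).
have -> : \sum_t h t =
    #|V|%:R - 1 + sgn_gram x y + sgn_gram x z + sgn_gram y z.
  rewrite -(sgn_gramxx x) /sgn_gram -!big_split /=; apply: eq_bigr => t _.
  rewrite /h; ring.
(* Either value is -1 modulo 4, which turns the [n - 1] from the squares in [h] into [n]. *)
have : a + b + c = 3 \/ a + b + c = - 1.
  rewrite /a /b /c (sgn_domC x y) (sgn_domC x z) (sgn_domC y z) !sgn_domE //.
  by case: (dom x y); case: (dom x z); case: (dom y z); (by left) || (by right).
move: a b c (sgn_gram _ _) (sgn_gram _ _) (sgn_gram _ _) (#|V|%:R : int) => a b c.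
lia.
Qed.

(** The [n - 2] terms with [t] outside [{x, y}] are signs, hence odd, and the other two vanish. *)
Lemma sgn_gram_mod2 x y : x != y -> (2 %| sgn_gram x y - #|V|%:R)%Z.
Proof.
move=> xy.
have H : (2 %|
    \sum_t (sgn_dom x t * sgn_dom y t - 1 + (x == t)%:R * 1 + (y == t)%:R * 1))%Z.
  apply: rpred_sum => t _.
  have [xt|xt] := eqVneq x t.
    by subst t; rewrite sgn_domxx (eq_sym y) (negPf xy) !mul0r mul1r.
  have [yt|yt] := eqVneq y t; first by subst t; rewrite sgn_domxx mulr0.
  by rewrite !sgn_domE //; case: (dom x t); case: (dom y t).
move: H; rewrite !big_split /= !(sum_pick (fun=> _)) sumrN sum_card_const mulr1.
by rewrite -/(sgn_gram x y); move: (sgn_gram x y) (#|V|%:R : int) => g n; lia.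
Qed.

(** * Lower bounds for [G] and their equality cases *)

Lemma gram_offdiag_ge0 : 0 <= gram_offdiag.
Proof.
by do 2!(apply: sumr_ge0 => ? _); rewrite mulr_ge0 ?ler0n ?sqr_ge0.
Qed.

Lemma gram_offdiag_eq0 :
  gram_offdiag = 0 <-> forall x y, x != y -> sgn_gram x y = 0.
Proof.
split=> [H x y xy|H]; last first.
  rewrite /gram_offdiag big1 // => x _; rewrite big1 // => y _.
  by have [->|/H ->] := eqVneq x y; rewrite ?mul0r ?mulr0.
have ge0 u v : 0 <= (u != v)%:R * sgn_gram u v ^+ 2.
  by rewrite mulr_ge0 ?ler0n ?sqr_ge0.
have Hx : \sum_v (x != v)%:R * sgn_gram x v ^+ 2 = 0.
  by apply: (psumr_eq0P _ H) => // u _; apply: sumr_ge0.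
have := psumr_eq0P (fun v _ => ge0 x v) Hx (i := y) isT.
by rewrite xy mul1r => /eqP; rewrite sqrf_eq0 => /eqP.
Qed.

Lemma gram_offdiag_excess :
  \sum_x \sum_y (x != y)%:R * (sgn_gram x y ^+ 2 - 1) =
    gram_offdiag - #|V|%:R * (#|V|%:R - 1).
Proof.
rewrite -sum_card_const -sumrN -big_split /=; apply: eq_bigr => x _.
rewrite -(sum_neq x) -sumrN -big_split /=; apply: eq_bigr => y _.
by rewrite mulrBr mulr1.
Qed.

(** For an odd number of vertices the off-diagonal Gram entries are odd, so their squares are at
    least 1. *)
Lemma gram_excess_ge0 x y : odd #|V| ->
  0 <= (x != y)%:R * (sgn_gram x y ^+ 2 - 1).
Proof.
move=> oV; have [->|/sgn_gram_mod2] := eqVneq x y; first by rewrite mul0r.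
rewrite mul1r; move: (sgn_gram x y) => g; nia.
Qed.

Lemma gram_offdiag_odd : odd #|V| -> #|V|%:R * (#|V|%:R - 1) <= gram_offdiag.
Proof.
move=> oV; rewrite -subr_ge0 -gram_offdiag_excess.
by do 2!(apply: sumr_ge0 => ? _); apply: gram_excess_ge0.
Qed.

Lemma gram_offdiag_odd_eq : odd #|V| ->
  gram_offdiag = #|V|%:R * (#|V|%:R - 1) <->
    forall x y, x != y -> sgn_gram x y ^+ 2 = 1.
Proof.
move=> oV; split=> [|H]; last first.
  apply/eqP; rewrite -subr_eq0 -gram_offdiag_excess big1 // => x _.
  rewrite big1 // => y _.
  by have [->|/H ->] := eqVneq x y; rewrite ?mul0r // subrr mulr0.
move/eqP; rewrite -subr_eq0 -gram_offdiag_excess => /eqP H x y xy.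
have Hx : \sum_v (x != v)%:R * (sgn_gram x v ^+ 2 - 1) = 0.
  by apply: (psumr_eq0P _ H) => // u _; apply: sumr_ge0 => v _;
    apply: gram_excess_ge0.
have := psumr_eq0P (fun v _ => gram_excess_ge0 x v oV) Hx (i := y) isT.
by rewrite xy mul1r => /eqP; rewrite subr_eq0 => /eqP.
Qed.

End Tournament.

(** * From Gram entries to skew-conference matrices *)

Lemma scalemx_intI (m p : nat) (c : int) (A B : 'M[int]_(m, p)) :
  c != 0 -> c *: A = c *: B -> A = B.
Proof.
move=> c0 /matrixP E; apply/matrixP => i j; have := E i j.
by rewrite !mxE => /(mulfI c0).
Qed.

Lemma sign_vector_normsq (n : nat) (v : 'cV[int]_n) :
  (forall i, v i 0 ^+ 2 = 1) -> v^T *m v = n%:R%:M.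
Proof.
move=> v1; apply/matrixP => i j; rewrite !ord1 !mxE eqxx mulr1n.
under eq_bigr => k _ do rewrite mxE -expr2 v1.
by rewrite sumr_const card_ord.
Qed.

Section SeidelMatrix.

Variables (n : nat) (dom : rel 'I_n).
Hypothesis dom_tournament : tournament dom.

Local Notation S := (seidel dom).

Lemma seidelE i j : S i j = sgn_dom dom i j.
Proof. by rewrite !mxE. Qed.

Lemma seidel_tr : S^T = - S.
Proof. by rewrite /seidel linearB /= trmxK opprB. Qed.

Lemma seidel_pm1 i j : i != j -> S i j = -1 \/ S i j = 1.
Proof.
by move=> ij; rewrite seidelE sgn_domE //; case: dom; [right|left].
Qed.

Lemma seidel_gramE i j : (S *m S^T) i j = sgn_gram dom i j.
Proof. by rewrite mxE; apply: eq_bigr => k _; rewrite [S^T _ _]mxE !seidelE. Qed.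

Lemma skew_conference_seidel :
  skew_conference S <-> forall i j, i != j -> sgn_gram dom i j = 0.
Proof.
split=> [[_ _ _ E] i j ij|H].
  by rewrite -seidel_gramE E mxE (negPf ij) mulr0n.
split; [|exact: seidel_pm1|exact: seidel_tr|].
  by move=> i; rewrite seidelE sgn_domxx.
apply/matrixP => i j; rewrite seidel_gramE mxE.
have [->|/H ->] := eqVneq i j; last by rewrite mulr0n.
by rewrite sgn_gramxx // card_ord mulr1n.
Qed.

(** Two distinct rows of [C] other than row [k] are orthogonal; dropping column [k] removes a
    product of two signs, so what remains is 1 or -1. *)
Lemma skew_conference_minor_gram (C : 'M[int]_n.+1) k :
  skew_conference C -> S = row' k (col' k C) ->
  forall i j, i != j -> sgn_gram dom i j ^+ 2 = 1.
Proof.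
case=> _ pm1 _ CC SE i j ij.
have nkl u : lift k u != k by rewrite eq_sym neq_lift.
have : (C *m C^T) (lift k i) (lift k j) = 0.
  by rewrite CC mxE (inj_eq lift_inj) (negPf ij) mulr0n.
rewrite mxE (bigD1_ord k) //= mxE => /eqP; rewrite addrC addr_eq0.
under eq_bigr => u _ do rewrite mxE.
have -> : \sum_u C (lift k i) (lift k u) * C (lift k j) (lift k u) =
    sgn_gram dom i j.
  by apply: eq_bigr => u _; rewrite -!seidelE SE !mxE.
move/eqP->.
by case: (pm1 _ _ (nkl i)) => ->; case: (pm1 _ _ (nkl j)) => ->.
Qed.

(* [S] commutes with [S S^T], hence with [v v^T]; as [v^T S v = 0], this
   forces [S v = 0]. *)
Lemma seidel_gram_rank1 (e : int) (v : 'cV[int]_n) : (1 < n)%N ->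
  e = 1 \/ e = -1 -> (forall i, v i 0 ^+ 2 = 1) ->
  (forall i j, i != j -> sgn_gram dom i j = e * v i 0 * v j 0) ->
  e = -1 /\ S *m v = 0.
Proof.
move=> n1 e1 v1 H.
have SST : S *m S^T = (n%:R - 1 - e)%:M + e *: (v *m v^T).
  apply/matrixP => i j; rewrite seidel_gramE !mxE big_ord1 !mxE.
  have [->|/H ->] := eqVneq i j; last by rewrite mulr0n add0r mulrA.
  by rewrite sgn_gramxx // card_ord mulr1n -expr2 v1 mulr1 subrK.
have vv := sign_vector_normsq v1.
(* Skew symmetry makes this 1 by 1 matrix equal to its own negative. *)
have vSv : v^T *m S *m v = 0.
  have : (v^T *m S *m v)^T = - (v^T *m S *m v).
    by rewrite !trmx_mul trmxK seidel_tr mulNmx mulmxN mulmxA.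
  move/matrixP => E; apply/matrixP => i j; move: (E i j); rewrite !ord1 !mxE.
  by move: (\sum_j0 _) => a; lia.
have n0 : n%:R != 0 :> int by rewrite pnatr_eq0; lia.
have e0 : e != 0 by case: e1 => ->.
have comm : S *m (v *m v^T) = v *m v^T *m S.
  have : S *m (S *m S^T) = S *m S^T *m S.
    by rewrite seidel_tr !mulmxN mulNmx mulmxA.
  rewrite SST mulmxDr [_ *m S]mulmxDl scalar_mxC => /addrI.
  by rewrite -scalemxAr -scalemxAl => /(scalemx_intI e0).
have Sv : S *m v = 0.
  have : S *m (v *m v^T) *m v = 0.
    by rewrite comm -!mulmxA [v^T *m _]mulmxA vSv mulmx0.
  rewrite -!mulmxA vv mul_mx_scalar -scalemxAr => E.
  by apply: (scalemx_intI n0); rewrite scaler0.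
split=> //; case: e1 => // e1.
(* If [e = 1], then [v] is also an eigenvector of [S S^T] for [(n - 2) + n], which is nonzero as
   [n > 1]. *)
have : S *m S^T *m v = 0 by rewrite seidel_tr mulmxN mulNmx -mulmxA Sv mulmx0 oppr0.
rewrite SST e1 scale1r mulmxDl -mulmxA vv mul_scalar_mx mul_mx_scalar -scalerDl.
move/matrixP/(_ (Ordinal (ltnW n1)) 0); rewrite !mxE => /eqP.
rewrite mulf_eq0 => /orP [/eqP|/eqP E]; first by lia.
by have := v1 (Ordinal (ltnW n1)); rewrite E.
Qed.

(** For three Gram entries that are signs, the congruence modulo 4 fixes their product: it is 1 if
    [n] is 1 modulo 4 and -1 if [n] is 3 modulo 4. This product is [e]. *)
Lemma gram_sign_vector : (1 < n)%N -> odd n ->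
  (forall i j, i != j -> sgn_gram dom i j ^+ 2 = 1) ->
  exists (e : int) (v : 'cV[int]_n),
    [/\ e = if (n %% 4 == 1)%N then 1 else -1, forall i, v i 0 ^+ 2 = 1 &
        forall i j, i != j -> sgn_gram dom i j = e * v i 0 * v j 0].
Proof.
move=> n1 on H; pose e : int := if (n %% 4 == 1)%N then 1 else -1.
pose o := Ordinal (ltnW n1).
(* Normalising [v] to 1 at the base vertex [o] forces the other entries, since [e * e = 1]. *)
pose v : 'cV[int]_n := \col_i if i == o then 1 else e * sgn_gram dom o i.
have ee : e * e = 1 by rewrite /e; case: ifP.
exists e, v; split=> //.
  move=> i; rewrite mxE; have [//|io] := eqVneq i o.
  by rewrite exprMn H 1?eq_sym // expr2 ee.
move=> i j ij; rewrite !mxE.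
have [io|io] := eqVneq i o; have [jo|jo] := eqVneq j o.
- by rewrite io jo eqxx in ij.
- by rewrite io mulr1 mulrA ee mul1r.
- by rewrite jo mulr1 mulrA ee mul1r sgn_gramC.
have U : uniq [:: o; i; j] by rewrite /= !inE negb_or ![o == _]eq_sym io jo ij.
have := sgn_gram_mod4 dom_tournament U.
have := H _ _ ij; have := H o i; have := H o j.
rewrite ![o == _]eq_sym => /(_ jo) A /(_ io) B C.
rewrite card_ord !mulrA ee mul1r /e.
have pm (a : int) : a ^+ 2 = 1 -> a = 1 \/ a = -1.
  by move/eqP; rewrite sqrf_eq1 => /orP [] /eqP; [left|right].
case: (pm _ A) => ->; case: (pm _ B) => ->; case: (pm _ C) => ->;
  case: ifP; lia.
Qed.

(** In the product of the bordered matrix with its transpose, the corner is [v^T v = n], the cross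
    blocks vanish by [S v = 0], and [v v^T] cancels the off-diagonal part of [S S^T]. *)
Lemma skew_conference_border (v : 'cV[int]_n) :
  (forall i, v i 0 ^+ 2 = 1) -> S *m v = 0 ->
  (forall i j, i != j -> sgn_gram dom i j = - v i 0 * v j 0) ->
  skew_conference (block_mx 0 v^T (- v) S : 'M_(1 + n)).
Proof.
move=> v1 Sv H.
have pm i : v i 0 = -1 \/ v i 0 = 1.
  by have /eqP := v1 i; rewrite sqrf_eq1 => /orP [] /eqP; [right|left].
split.
- move=> i; have [k ->|k ->] := split_ordP i.
    by rewrite block_mxEul mxE.
  by rewrite block_mxEdr seidelE sgn_domxx.
- move=> i j; have [k ->|k ->] := split_ordP i; have [l ->|l ->] := split_ordP j.
  + by rewrite !ord1 eqxx.
  + by move=> _; rewrite block_mxEur mxE ord1.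
  + by move=> _; rewrite block_mxEdl mxE ord1; case: (pm k) => ->; [right|left].
  + by rewrite (inj_eq (@rshift_inj _ _)) block_mxEdr; apply: seidel_pm1.
- by rewrite tr_block_mx opp_block_mx trmxK linearN /= seidel_tr trmx0 oppr0 opprK.
rewrite tr_block_mx mulmx_block !trmxK !trmx0 linearN /= !mul0mx mulmx0 !add0r.
have vS : v^T *m S^T = 0 by rewrite -trmx_mul Sv trmx0.
rewrite vS Sv mulNmx mulmxN opprK.
rewrite (sign_vector_normsq v1).
have -> : v *m v^T + S *m S^T = n%:R%:M.
  apply/matrixP => i j; rewrite mxE seidel_gramE !mxE big_ord1 mxE.
  have [->|/H ->] := eqVneq i j; last by rewrite mulr0n mulNr subrr.
  by rewrite sgn_gramxx // card_ord -expr2 v1 mulr1n addrC subrK.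
by rewrite natrD addrC addKr -scalar_mx_block.
Qed.

Lemma row'_col'_border (v : 'cV[int]_n) :
  S = row' ord0 (col' ord0 (block_mx 0 v^T (- v) S : 'M_(1 + n))).
Proof.
apply/matrixP => i j; rewrite [RHS]mxE [RHS]mxE -!rshift1.
exact/esym/(block_mxEdr (0 : 'M_1) v^T (- v) (seidel dom)).
Qed.

(** * Rational form of the bounds and conclusion *)

Lemma diamonds_rat :
  (diamonds dom)%:R = 1 / 96 * n%:R ^+ 2 * (n%:R - 1) * (n%:R - 2)
    - 1 / 32 * (gram_offdiag dom)%:~R :> rat.
Proof.
have := diamonds_gram_offdiag dom_tournament; rewrite card_ord.
move/(congr1 (fun z : int => z%:~R : rat)).
rewrite !(rmorphM, rmorphB, rmorphXn) /= !(rmorph_nat, rmorph1) => E.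
apply: (@mulfI _ 96) => //; rewrite E; by field.
Qed.

(** The odd bound is the even one lowered by the least value [N (N - 1)] of [G]. *)
Lemma odd_bound_rat (N : rat) :
  1 / 96 * N * (N - 1) * (N - 3) * (N + 1) =
    1 / 96 * N ^+ 2 * (N - 1) * (N - 2) - 1 / 32 * (N * (N - 1)).
Proof. by field. Qed.

End SeidelMatrix.

(** The equality cases exclude [n = 2] and [n = 1]: there the bound and the number of diamonds are
    both 0, yet the congruence on [n] fails. *)
Theorem theorem1 (n : nat) (dom : rel 'I_n) (dom_tournament : tournament dom) :
  (~~ odd n ->
     (diamonds dom)%:R <= 1 / 96 * n%:R ^+ 2 * (n%:R - 1) * (n%:R - 2) :> rat
     /\ (n <> 2%N ->
         ((diamonds dom)%:R = 1 / 96 * n%:R ^+ 2 * (n%:R - 1) * (n%:R - 2) :> rat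
          <-> (n = 0 %[mod 4])%N /\ skew_conference (seidel dom))))
  /\
  (odd n ->
     (diamonds dom)%:R
       <= 1 / 96 * n%:R * (n%:R - 1) * (n%:R - 3) * (n%:R + 1) :> rat
     /\ (n <> 1%N ->
         ((diamonds dom)%:R
            = 1 / 96 * n%:R * (n%:R - 1) * (n%:R - 3) * (n%:R + 1) :> rat
          <-> (n = 3 %[mod 4])%N /\
              exists (C : 'M[int]_n.+1) (k : 'I_n.+1),
                skew_conference C /\ seidel dom = row' k (col' k C)))).
Proof.
have dE := diamonds_rat dom_tournament.
split=> parity; (split=> [|n_neq]; rewrite {}dE).
- have sub_le (B G : rat) : 0 <= G -> B - 1 / 32 * G <= B by lra.
  by apply: sub_le; rewrite ler0z gram_offdiag_ge0.
- have -> (B G : rat) : (B - 1 / 32 * G = B) <-> G = 0 by split=> ?; lra.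
  split=> [/eqP|[_ conf]].
    rewrite intr_eq0 => /eqP/gram_offdiag_eq0 gram0.
    split; last exact/skew_conference_seidel.
    (* With three vertices available and all their Gram entries zero, the congruence modulo 4 reads
       [4 | n]. *)
    have [->//|n_gt2] : n = 0%N \/ (2 < n)%N by lia.
    pose x := Ordinal (ltnW (ltnW n_gt2)); pose y := Ordinal (ltnW n_gt2).
    pose z := Ordinal n_gt2.
    have [xy xz yz] : [/\ x != y, x != z & y != z] by [].
    have := @sgn_gram_mod4 _ _ dom_tournament x y z isT.
    rewrite (gram0 _ _ xy) (gram0 _ _ xz) (gram0 _ _ yz) card_ord !addr0.
    by clear; lia.
  apply/eqP; rewrite intr_eq0; apply/eqP/gram_offdiag_eq0.
  exact/skew_conference_seidel.
- have sub_le (B G H : rat) : H <= G -> B - 1 / 32 * G <= B - 1 / 32 * H by lra.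
  rewrite [leRHS]odd_bound_rat; apply: sub_le.
  have := gram_offdiag_odd dom_tournament; rewrite card_ord => /(_ parity).
  by rewrite -(ler_int rat) rmorphM rmorphB /= rmorph_nat rmorph1.
rewrite [X in _ = X <-> _]odd_bound_rat.
have -> (B G H : rat) : (B - 1 / 32 * G = B - 1 / 32 * H) <-> G = H.
  by split=> ?; lra.
have -> : ((gram_offdiag dom)%:~R = n%:R * (n%:R - 1) :> rat) <->
    (gram_offdiag dom = n%:R * (n%:R - 1)).
  split=> [E|->]; last by rewrite rmorphM rmorphB /= rmorph_nat rmorph1.
  by apply: (@intr_inj rat); rewrite E rmorphM rmorphB /= rmorph_nat rmorph1.
have := gram_offdiag_odd_eq dom_tournament; rewrite card_ord => /(_ parity) ->.
split=> [gram1|[_ [C [k [conf SE]]]]];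
  last exact: skew_conference_minor_gram conf SE.
have n_gt1 : (1 < n)%N by lia.
have [e [v [eE v1 ev]]] := gram_sign_vector dom_tournament n_gt1 parity gram1.
have [|eN Sv] := seidel_gram_rank1 dom_tournament n_gt1 _ v1 ev.
  by rewrite eE; case: ifP; [left|right].
(* By the choice of [e], the value -1 rules out 1 modulo 4, leaving 3 for odd [n]. *)
split; first by move: eE; rewrite eN; case: ifP => //; lia.
exists (block_mx 0 v^T (- v) (seidel dom) : 'M_(1 + n)), ord0.
split; last exact: row'_col'_border.
apply: skew_conference_border => // i j ij.
by rewrite ev // eN mulN1r.
Qed.
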